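(* There is a VI problem $\mathrm{VI}([-1,1]^2,F)$, with $F:[-1,1]^2\to\mathbb R^2$, that satisfies the Minty condition, but that has an exact expected VI solution $\mu\in\Delta([-1,1]^2)$ such that (1) $\mathbb E_{x\sim\mu}\,x$ is not an SVI solution, and (2) no point in the support of $\mu$ is an SVI solution.
   Context: Let $\mathcal X=[-1,1]^2$. An SVI solution is $x\in\mathcal X$ with $\langle F(x),x'-x\rangle\ge0$ for all $x'\in\mathcal X$. The Minty condition: there is $x\in\mathcal X$ with $\langle F(x'),x'-x\rangle\ge0$ for all $x'\in\mathcal X$. An exact expected VI (EVI) solution is a probability distribution $\mu\in\Delta(\mathcal X)$ over $\mathcal X$ with $\mathbb E_{x\sim\mu}\langle F(x),x'-x\rangle\ge0$ for all $x'\in\mathcal X$. As throughout the paper, $F$ is a Lipschitz continuous mapping. *)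

(* Defs.v *)
From mathcomp Require Import all_boot all_order all_algebra.
From mathcomp Require Import all_classical all_reals all_analysis.

Set Implicit Arguments.
Unset Strict Implicit.
Unset Printing Implicit Defensive.

Import Order.TTheory GRing.Theory Num.Theory.
Import numFieldNormedType.Exports.

Local Open Scope classical_set_scope.
Local Open Scope ring_scope.

(* The plane is R * R: its canonical topology is the product topology and its
   canonical sigma-algebra, the product one, is the Borel sigma-algebra. *)

Definition dot (R : realType) (u v : R * R) : R := u.1 * v.1 + u.2 * v.2.

Definition square (R : realType) : set (R * R) := `[-1, 1] `*` `[-1, 1].

(* A map F : X -> R^2 is represented by a total function; only its values on X
   are used below. *)

Definition svi_solution (R : realType) (X : set (R * R)) (F : R * R -> R * R)
    (x : R * R) : Prop :=
  X x /\ forall x', X x' -> 0 <= dot (F x) (x' - x).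

Definition minty (R : realType) (X : set (R * R)) (F : R * R -> R * R) : Prop :=
  exists2 x, X x & forall x', X x' -> 0 <= dot (F x') (x' - x).

(* A distribution on X is a Borel probability on the plane with mu X = 1; the
   expectation is taken over X because F need not be measurable outside X. *)
Definition evi_solution (R : realType) (X : set (R * R)) (F : R * R -> R * R)
    (mu : probability (R * R)%type R) : Prop :=
  mu X = 1%E /\
  forall x', X x' -> (0 <= \int[mu]_(x in X) (dot (F x) (x' - x))%:E)%E.

Definition mean (R : realType) (X : set (R * R))
    (mu : probability (R * R)%type R) : R * R :=
  (\int[mu]_(x in X) x.1, \int[mu]_(x in X) x.2).

Definition msupport (R : realType) (mu : probability (R * R)%type R) :
    set (R * R) :=
  [set x | forall U : set (R * R), open U -> U x -> (0 < mu U)%E].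

(* Main.v *)
(** Minty holds at the origin as soon as [F x] is orthogonal to [x], so take
    [F x = (1 + x.1) *: J x] with [J] the rotation by a quarter turn.  The
    points [(1/2, 0)] and [(-1/2, 0)] with weights [1/4] and [3/4] average [F]
    to zero, hence form an exact EVI solution, but the mean [(-1/4, 0)] and both
    points are interior points of the square at which [F] does not vanish. *)

Require Import Defs.
From mathcomp Require Import all_boot all_order all_algebra.
From mathcomp Require Import all_classical all_reals all_analysis.
From mathcomp Require Import measurable_realfun ring lra.
Import Order.TTheory GRing.Theory Num.Theory.
Import numFieldNormedType.Exports.
Local Open Scope classical_set_scope.
Local Open Scope ring_scope.

Section two_point_distribution.
Context d (T : measurableType d) (R : realType).
Variables (p : R) (a b : T).
Implicit Types D : set T.

Let choose_point (c : bool) : T := if c then a else b.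

Let measurable_choose_point : measurable_fun setT choose_point.
Proof. by []. Qed.

Let choose_point_mixin := isMeasurableFun.Build _ _ _ _ _ measurable_choose_point.

(** As the law of [choose_point] under a Bernoulli variable, this is a probability by construction,
    and its integrals reduce to integrals over [bool]. *)
Definition two_point : probability T R :=
  distribution (bernoulli_prob p)
    (MeasurableFun.Pack (MeasurableFun.Class choose_point_mixin)).

Hypothesis p01 : 0 <= p <= 1.

Lemma two_point1 D : D a -> D b -> two_point D = 1%E.
Proof.
move=> Da Db; rewrite /two_point /= /distribution /pushforward /=.
by rewrite (_ : _ @^-1` _ = setT) ?probability_setT//; apply/seteqP; split=> -[].
Qed.

Lemma two_point0 D : ~ D a -> ~ D b -> two_point D = 0%E.
Proof.
move=> Da Db; rewrite /two_point /= /distribution /pushforward /=.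
by rewrite (_ : _ @^-1` _ = set0) ?measure0//; apply/seteqP; split=> -[].
Qed.

Lemma integral_bernoulli_prob_EFin (f : bool -> R) :
  (\int[bernoulli_prob p]_x (f x)%:E = (p * f true + (1 - p) * f false)%:E)%E.
Proof.
rewrite setT_bool integral_setU//=; last first.
  by apply/disj_setPS => -[] [].
rewrite (eq_integral (cst (f true)%:E)); last by move=> x /[!inE] /= ->.
rewrite [X in (_ + X)%E](eq_integral (cst (f false)%:E)); last first.
  by move=> x /[!inE] /= ->.
rewrite !integral_cst//= !bernoulli_probE// !diracE !in_set1 ?eqxx /=.
by rewrite /unstable.onem; congr (_%:E); ring.
Qed.

(** Change of variables along [choose_point]: since [D] contains both atoms, its preimage is all of
    [bool]. *)
Lemma integral_two_point D (f : T -> R) :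
  measurable D -> measurable_fun setT f -> D a -> D b ->
  (\int[two_point]_(x in D) (f x)%:E = (p * f a + (1 - p) * f b)%:E)%E.
Proof.
move=> mD mf Da Db.
have preD : choose_point @^-1` D = setT by apply/seteqP; split=> -[].
rewrite /two_point /= /distribution integral_pushforward//=; last 2 first.
- exact/measurable_EFinP.
- rewrite preD; apply/measurable_bounded_integrable => //=.
  + by rewrite probability_setT ltry.
  (* The pulled-back integrand takes only the values [f a] and [f b], so it is bounded. *)
  + exists (`|f a| + `|f b|); split => [|M M1 [] _ /=]; first exact: num_real.
    * by apply/ltW/(le_lt_trans _ M1); rewrite lerDl.
    * by apply/ltW/(le_lt_trans _ M1); rewrite lerDr.
by rewrite preD (integral_bernoulli_prob_EFin (f \o choose_point)).
Qed.

End two_point_distribution.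
Arguments two_point {d T R}.
Arguments integral_two_point {d T R p a b}.

(** Points are closed in the plane, so the complement of [[set a; b]] is an open set, and it has
    measure zero. *)
Lemma msupport_two_point (R : realType) (p : R) (a b x : R * R) :
  msupport (two_point p a b) x -> x = a \/ x = b.
Proof.
move=> supp; apply: contrapT => xab.
have opC : open (~` [set a; b]).
  rewrite openC; apply: closedU;
    exact/accessible_closed_set1/hausdorff_accessible/norm_hausdorff.
have := supp _ opC xab; rewrite two_point0 ?ltxx// => abs; apply: abs.
  by left.
by right.
Qed.

(** The factor [1 + x.1] breaks linearity: for the rotation alone, a distribution averaging the map
    to zero would have mean zero, and the origin is an SVI solution. *)
Definition skewed_rotation {R : realType} (x : R * R) : R * R :=
  (- ((1 + x.1) * x.2), (1 + x.1) * x.1).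

Section skewed_rotation.
Context {R : realType}.
Implicit Types x y : R * R.
Local Notation F := (@skewed_rotation R).

Lemma squareE x :
  @square R x <-> [/\ -1 <= x.1, x.1 <= 1, -1 <= x.2 & x.2 <= 1].
Proof.
rewrite /square /= !in_itv /=; split.
  by move=> [/andP[-> ->] /andP[-> ->]].
by move=> [-> -> -> ->].
Qed.

Lemma measurable_square : measurable (@square R).
Proof. by apply: measurableX; exact: measurable_itv. Qed.

Lemma dot_skewed_rotation x : dot (F x) x = 0.
Proof. by rewrite /dot /=; ring. Qed.

Lemma lipschitz_skewed_rotation : [lipschitz F x | x in @square R].
Proof.
(* The constant 3 comes from [(1 + x1) * x2 - (1 + y1) * y2 = (1 + x1) * (x2 - y2) + y2 * (x1 - y1)]
   and [(1 + x1) * x1 - (1 + y1) * y1 = (1 + x1 + y1) * (x1 - y1)], with the max norm on the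
   plane. *)
apply: (@klipschitzW _ _ _ 3).
  apply: (@globally_properfilter _ _ (0, 0)).
  by split; apply/squareE; split => /=; lra.
move=> [[x1 x2] [y1 y2]] [/= /squareE[/= xa xb xc xd] /squareE[/= ya yb yc yd]].
rewrite !prod_normE /= ge_max.
set N := Num.max _ _.
have N1 : `|x1 - y1| <= N by rewrite le_max lexx.
have N2 : `|x2 - y2| <= N by rewrite le_max lexx orbT.
move: N1 N2; rewrite !ler_norml => /andP[? ?] /andP[? ?].
by apply/andP; split; apply/andP; split; nra.
Qed.

Lemma minty_skewed_rotation : minty (@square R) F.
Proof.
exists 0; first by apply/squareE; split => /=; lra.
by move=> x _; rewrite subr0 dot_skewed_rotation.
Qed.

(** On the horizontal axis [F x] is vertical, with second coordinate [(1 + x.1) * x.1]. Testing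
    against the points straight above and below on the boundary forces that coordinate to be both
    nonnegative and nonpositive. *)
Lemma not_svi_skewed_rotation x :
  x.2 = 0 -> (1 + x.1) * x.1 != 0 -> ~ svi_solution (@square R) F x.
Proof.
case: x => s t /= -> Fs0 [/squareE[/= ? ? _ _] sol].
have := sol (s, 1); have := sol (s, -1); rewrite /dot /= => h1 h2.
have {}h1 := h1 ltac:(by apply/squareE; split => /=; lra).
have {}h2 := h2 ltac:(by apply/squareE; split => /=; lra).
by move/eqP: Fs0; apply; lra.
Qed.

Lemma measurable_dot_skewed_rotation y :
  measurable_fun setT (fun x => dot (F x) (y - x)).
Proof.
have m1 : measurable_fun setT (fun x : R * R => x.1) by exact: measurable_fst.
have m2 : measurable_fun setT (fun x : R * R => x.2) by exact: measurable_snd.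
rewrite /dot /=; apply: measurable_funD; apply: measurable_funM.
- apply: measurableT_comp => //.
  by apply: measurable_funM => //; exact: measurable_funD.
- exact: measurable_funB.
- by apply: measurable_funM => //; exact: measurable_funD.
- exact: measurable_funB.
Qed.

End skewed_rotation.

Theorem proposition6p12 (R : realType) :
  exists F : R * R -> R * R,
    [/\ [lipschitz F x | x in @square R],
        minty (@square R) F &
        exists mu : probability (R * R)%type R,
          [/\ evi_solution (@square R) F mu,
              ~ svi_solution (@square R) F (mean (@square R) mu) &
              forall x, msupport mu x -> ~ svi_solution (@square R) F x]].
Proof.
exists skewed_rotation; split.
- exact: lipschitz_skewed_rotation.
- exact: minty_skewed_rotation.
pose a : R * R := (2^-1, 0); pose b : R * R := (- 2^-1, 0).
have Sa : @square R a by apply/squareE; split => /=; lra.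
have Sb : @square R b by apply/squareE; split => /=; lra.
have p01 : 0 <= (4^-1 : R) <= 1 by apply/andP; split; lra.
have mS := @measurable_square R.
exists (two_point 4^-1 a b); split.
- split=> [|y _]; first exact: two_point1.
  rewrite (integral_two_point _ _ (fun x => dot (skewed_rotation x) (y - x)))//.
    (* [F a = (0, 3/4)] and [F b = (0, -1/4)], so the expectation is [1/4 * (3/4 * y.2) - 3/4 * (1/4
       * y.2) = 0]. *)
    by rewrite lee_fin /dot /=; lra.
  exact: measurable_dot_skewed_rotation.
- rewrite /mean /Rintegral !integral_two_point//=.
  (* At the mean [(-1/4, 0)] the second coordinate of the map is [-3/16]. *)
  by apply: not_svi_skewed_rotation => /=; [ring|apply/eqP; lra].
- move=> x /msupport_two_point[] ->; apply: not_svi_skewed_rotation => //=;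
    by apply/eqP; lra.
Qed.
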